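(* Let $k\ge 3$, let $G=(V,E)$ be a $k$-uniform hypergraph with $n$ vertices and let $G'$ be a sub-hypergraph of $G$. Let $\mathcal Q$ and $\mathcal Q'$ be the signless Laplacian tensors of $G$ and $G'$, respectively. Then $\lambda(\mathcal Q')\le\lambda(\mathcal Q)$. Furthermore, if $G'$ and $G$ are both connected, then $\lambda(\mathcal Q')=\lambda(\mathcal Q)$ if and only if $G'=G$. Consequently, $$\lambda(\mathcal Q)\le 2\binom{n-1}{k-1},$$ and equality holds if and only if $G$ is the $k$-uniform complete hypergraph.
   Context: Hypergraphs are undirected, simple, $k$-uniform (every edge has exactly $k$ vertices), with vertex set $V=[n]=\{1,\dots,n\}$ (up to relabeling), $n\ge k$, and nonempty edge set $E$. A sub-hypergraph of $G=(V,E)$ is a ($k$-uniform, nontrivial) hypergraph $G'=(V',E')$ with $V'\subseteq V$ and $E'\subseteq E$. $G$ is complete if $E$ consists of all $k$-element subsets of $V$. Two different vertices $i,j$ are connected if there are edges $e_1,\dots,e_m$ with $i\in e_1$, $j\in e_m$ and $e_r\cap e_{r+1}\ne\emptyset$ for all $r\in[m-1]$; $G$ is connected if every pair of different vertices is connected. The degree $d_i$ of vertex $i$ is the number of edges containing $i$. The adjacency tensor $\mathcal A$ is the $k$-th order $n$-dimensional tensor with $a_{i_1\dots i_k}=\frac1{(k-1)!}$ if $\{i_1,\dots,i_k\}\in E$ and $0$ otherwise; $\mathcal D$ is the diagonal tensor with diagonal entries $d_{i\dots i}=d_i$; the signless Laplacian tensor is $\mathcal Q=\mathcal D+\mathcal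 A$. Thus $(\mathcal Q\mathbf x^{k-1})_i=d_ix_i^{k-1}+\sum_{e\in E,\,i\in e}\prod_{j\in e\setminus\{i\}}x_j$. A real number $\lambda$ is an H-eigenvalue of $\mathcal Q$ with H-eigenvector $\mathbf x\in\mathbb R^n\setminus\{0\}$ if $(\mathcal Q\mathbf x^{k-1})_i=\lambda x_i^{k-1}$ for all $i\in[n]$. $\lambda(\mathcal Q)$ denotes the largest H-eigenvalue of $\mathcal Q$ (it exists). *)

(* Defs.v *)
From mathcomp Require Import all_boot all_order all_algebra.
From mathcomp Require Import boolp classical_sets reals.
Set Implicit Arguments.
Unset Strict Implicit.
Unset Printing Implicit Defensive.

Import Order.TTheory GRing.Theory Num.Theory.
Local Open Scope ring_scope.

(* The vertex set is a subset of an ambient finite type T, so that a           *)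
(* sub-hypergraph may have fewer vertices. The nonempty edge set and k-uniformity *)
(* imply k <= #|vset G|.                                                       *)
Record hypergraph (T : finType) (k : nat) := Hypergraph {
  vset : {set T};
  edges : {set {set T}};
  edges_sub : [forall e in edges, e \subset vset];
  edges_unif : [forall e in edges, #|e| == k];
  edges_neq0 : edges != finset.set0 }.

Definition vertex (T : finType) (k : nat) (G : hypergraph T k) : finType :=
  {x : T | x \in vset G}.

Definition subhypergraph (T : finType) (k : nat) (G' G : hypergraph T k) :=
  (vset G' \subset vset G) && (edges G' \subset edges G).

Definition complete (T : finType) (k : nat) (G : hypergraph T k) : Prop :=
  edges G = [set e : {set T} | (e \subset vset G) && (#|e| == k)]%SET.

(* The chain of edges is e :: es, hence nonempty. *)
Definition vconnected (T : finType) (k : nat) (G : hypergraph T k) (i j : T) : Prop :=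
  exists (e : {set T}) (es : seq {set T}),
    [/\ all (fun f => f \in edges G) (e :: es),
        path (fun f g : {set T} => (f :&: g)%SET != finset.set0) e es,
        i \in e & j \in last e es].

Definition hconnected (T : finType) (k : nat) (G : hypergraph T k) : Prop :=
  forall i j, i \in vset G -> j \in vset G -> i != j -> vconnected G i j.

Definition degree (T : finType) (k : nat) (G : hypergraph T k) (i : T) : nat :=
  #|[set e in edges G | i \in e]%SET|.

(* Real tensors of order k whose k indices range over I. *)
Definition tensor (R : realType) (I : finType) (k : nat) := {ffun k.-tuple I -> R}.

(* (A x^{k-1})_i, the sum over (i_2, .., i_k) of a_{i i_2 .. i_k} x_{i_2} .. x_{i_k}. *)
Definition tensor_app (R : realType) (I : finType) (k : nat) (A : tensor R I k)
    (x : {ffun I -> R}) (i : I) : R :=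
  \sum_(s : k.-tuple I | ohead s == Some i) A s * \prod_(j <- behead s) x j.

Definition Heigenpair (R : realType) (I : finType) (k : nat) (A : tensor R I k)
    (lambda : R) (x : {ffun I -> R}) : Prop :=
  x != 0 /\ forall i, tensor_app A x i = lambda * x i ^+ k.-1.

Definition Heigenvalues (R : realType) (I : finType) (k : nat)
    (A : tensor R I k) : set R :=
  [set lambda | exists x, Heigenpair A lambda x]%classic.

(* The largest H-eigenvalue; the value 0 is a default for tensors that have none. *)
Definition largest_Heigenvalue (R : realType) (I : finType) (k : nat)
    (A : tensor R I k) : R :=
  xget 0 (Heigenvalues A `&` ubound (Heigenvalues A))%classic.

Definition adjacency_tensor (R : realType) (T : finType) (k : nat) (G : hypergraph T k) :
    tensor R (vertex G) k :=
  [ffun s : k.-tuple (vertex G) =>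
    if [set val i | i in s]%SET \in edges G then ((k.-1)`!)%:R^-1 else 0 : R].

Definition degree_tensor (R : realType) (T : finType) (k : nat) (G : hypergraph T k) :
    tensor R (vertex G) k :=
  [ffun s : k.-tuple (vertex G) =>
    (if ohead s is Some i then
      if constant s then (degree G (val i))%:R else 0
    else 0) : R].

Definition signless_Laplacian (R : realType) (T : finType) (k : nat) (G : hypergraph T k) :
    tensor R (vertex G) k :=
  degree_tensor R G + adjacency_tensor R G.

(* Main.v *)
(* On nonnegative vectors Q x^k is Qform x, the sum over the edges e of
     sum_(i in e) x_i^k + k prod_(i in e) x_i,
   and the largest H-eigenvalue is the maximum of Qform x / sum_i x_i^k: a maximizer
   exists by compactness and satisfies the eigenvalue equations by stationarity in
   each coordinate, while replacing an H-eigenvector by its absolute value shows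
   that no H-eigenvalue is larger. Extending a maximizer of G' by zero gives the
   monotonicity. If equality holds, this extension is a maximizer for G; when G is
   connected every maximizer is positive, so G' misses no vertex and no edge.
   By AM-GM, Qform x <= 2 sum_i d_i x_i^k, and d_i is at most 'C(n-1, k-1), which
   gives the last bound; equality forces the AM-GM and degree inequalities to be
   tight, hence all x_i to be positive and all degrees to be maximal. *)
Require Import Defs.
From mathcomp Require Import topology normedtype derive realfun.
From mathcomp Require Import lra.
From mathcomp Require Import all_boot all_order all_algebra.
From mathcomp Require Import boolp classical_sets reals.
Set Implicit Arguments.
Unset Strict Implicit.
Unset Printing Implicit Defensive.

Import numFieldNormedType.Exports.
Import Order.TTheory GRing.Theory Num.Theory.
Local Open Scope ring_scope.

(* Vectors are functions on the ambient T, of which only the values on vset G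
   matter, so that those of G and of G' can be compared. *)
Definition edge_form (R : realType) (T : finType) (k : nat) (x : T -> R)
    (e : {set T}) : R :=
  \sum_(i in e) x i ^+ k + k%:R * \prod_(i in e) x i.

Definition Qform (R : realType) (T : finType) (k : nat) (G : hypergraph T k)
    (x : T -> R) : R :=
  \sum_(e in edges G) edge_form k x e.

Definition powsum (R : realType) (T : finType) (k : nat) (G : hypergraph T k)
    (x : T -> R) : R :=
  \sum_(i in vset G) x i ^+ k.

(** * Edges and homogeneity of the forms *)

Lemma edge_subset (T : finType) (k : nat) (G : hypergraph T k) (e : {set T}) :
  e \in edges G -> e \subset vset G.
Proof. by case: G => V E /= /forall_inP h _ _; exact: h. Qed.

Lemma card_edge (T : finType) (k : nat) (G : hypergraph T k) (e : {set T}) :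
  e \in edges G -> #|e| = k.
Proof. by case: G => V E /= _ /forall_inP h _ eE; apply/eqP/h. Qed.

Lemma edge_vset (T : finType) (k : nat) (G : hypergraph T k) (e : {set T}) i :
  e \in edges G -> i \in e -> i \in vset G.
Proof. by move=> /edge_subset/fintype.subsetP; exact. Qed.

Lemma Qform_scale (R : realType) (T : finType) (k : nat) (G : hypergraph T k)
    (c : R) (x y : T -> R) :
  {in vset G, forall i, y i = c * x i} -> Qform G y = c ^+ k * Qform G x.
Proof.
move=> h; rewrite /Qform mulr_sumr; apply: eq_bigr => e eE.
rewrite /edge_form mulrDr mulr_sumr; congr (_ + _).
  by apply: eq_bigr => i ie; rewrite h ?(edge_vset eE) // exprMn.
rewrite (eq_bigr (fun i => c * x i)); last by move=> i ie; rewrite h ?(edge_vset eE).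
by rewrite big_split /= prodr_const (card_edge eE) mulrCA.
Qed.

Lemma powsum_scale (R : realType) (T : finType) (k : nat) (G : hypergraph T k)
    (c : R) (x y : T -> R) :
  {in vset G, forall i, y i = c * x i} -> powsum G y = c ^+ k * powsum G x.
Proof.
move=> h; rewrite /powsum mulr_sumr; apply: eq_bigr => i iV.
by rewrite h // exprMn.
Qed.

(** * Continuity and existence of a maximizer *)

Lemma sum_continuous (R : realType) (X : topologicalType) (I : Type) (r : seq I)
    (P : pred I) (f : I -> X -> R) :
  (forall i, P i -> continuous (f i)) ->
  continuous (fun x => \sum_(i <- r | P i) f i x).
Proof.
move=> fc x; apply: cvg_big; last by move=> i Pi; exact: fc.
exact: add_continuous.
Qed.

Lemma prod_continuous (R : realType) (X : topologicalType) (I : Type) (r : seq I)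
    (P : pred I) (f : I -> X -> R) :
  (forall i, P i -> continuous (f i)) ->
  continuous (fun x => \prod_(i <- r | P i) f i x).
Proof.
move=> fc x; apply: cvg_big; last by move=> i Pi; exact: fc.
exact: mul_continuous.
Qed.

Lemma exprn_comp_continuous (R : realType) (X : topologicalType) (f : X -> R) n :
  continuous f -> continuous (fun x => f x ^+ n).
Proof.
move=> fc x.
exact: (@cvg_comp _ _ _ f (fun t => t ^+ n) _ _ _ (fc x) (@exprn_continuous R n (f x))).
Qed.

(** [l] is the maximum of [Qform] / [powsum] over nonnegative vectors, attained at [x]. Clearing the
    denominator lets the bound also cover vectors whose [powsum] is zero. *)
Definition extremal (R : realType) (T : finType) (k : nat) (G : hypergraph T k)
    (l : R) (x : T -> R) : Prop :=
  [/\ forall i, 0 <= x i, 0 < powsum G x, Qform G x = l * powsum G x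
    & forall y : T -> R, (forall i, 0 <= y i) -> Qform G y <= l * powsum G y].

(** Both forms are homogeneous of degree [k], so their quotient can be maximized on the standard
    simplex [B] over the vertices, which is compact and on which [powsum] is positive. *)
Lemma exists_extremal (R : realType) (T : finType) (k : nat) (k_gt0 : (0 < k)%N)
    (G : hypergraph T k) :
  exists (x : T -> R) (l : R),
    extremal G l x /\ (forall i, i \notin vset G -> x i = 0).
Proof.
pose X := prod_topology (fun _ : T => R : topologicalType).
pose V := vset G.
(* The factor for [i] outside [V] is the segment from 0 to 0, so members of [A] are supported on
   [V]; Tychonoff makes the product compact. *)
pose A : set X := [set x : X | (forall i, `[0, (i \in V)%:R : R]%classic (x i))]%classic.
pose S (x : T -> R) : R := \sum_(i in V) x i.
have cj i : continuous (fun x : X => x i : R).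
  exact: (@proj_continuous T (fun _ => R : topologicalType) i).
have cX i : continuous (fun x : X => (x i : R) ^+ k).
  by apply: exprn_comp_continuous; exact: cj.
have cS : continuous (S : X -> R) by apply: sum_continuous => i _; exact: cj.
have cN : continuous (powsum G : X -> R) by apply: sum_continuous => i _; exact: cX.
have cF : continuous (Qform G : X -> R).
  have c1 (e : {set T}) : continuous (fun x : X => \sum_(i in e) (x i : R) ^+ k).
    by apply: sum_continuous => i _; exact: cX.
  have c2 (e : {set T}) : continuous (fun x : X => \prod_(i in e) (x i : R)).
    by apply: prod_continuous => i _; exact: cj.
  have c3 (e : {set T}) : continuous (fun x : X => k%:R * \prod_(i in e) (x i : R)).
    by move=> x; exact: cvgMl_tmp (c2 e x).
  by apply: sum_continuous => e _ x; exact: cvgD (c1 e x) (c3 e x).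
pose B : set X := (A `&` (S : X -> R) @^-1` [set 1])%classic.
have cptA : compact A.
  exact: (@tychonoff T (fun=> R : topologicalType) (fun i => `[0, (i \in V)%:R]%classic)
    (fun i => @segment_compact R 0 _)).
have cptB : compact B.
  by apply: compact_closedI => //; apply: preimage_closed; [move=> x _; exact: cS|exact: closed_eq].
have Agt0 (x : X) : A x -> forall i, 0 <= (x i : R).
  by move=> Ax i; have := Ax i; rewrite /= in_itv /= => /andP[].
have A0 (x : X) : A x -> forall i, i \notin V -> x i = 0 :> R.
  by move=> Ax i /negbTE iV; have := Ax i; rewrite /= in_itv /= iV -eq_le => /eqP.
have N_gt0 (x : T -> R) : (forall i, 0 <= x i) -> 0 < S x -> 0 < powsum G x.
  move=> x0 Sx; have [i iV xi] : exists2 i, i \in V & 0 < x i.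
    apply/exists_inP; rewrite -[X in is_true X]negbK negb_exists_in; apply/negP => /forall_inP h.
    by move: Sx; rewrite /S big1 ?ltxx // => i /h; rewrite -leNgt => xi; apply/eqP; rewrite eq_le xi x0.
  rewrite /powsum (bigD1 i) //= ltr_pwDl ?exprn_gt0 // sumr_ge0 // => j _; exact: exprn_ge0.
have [v vV] : exists v, v \in V.
  have /set0Pn[e eE] := edges_neq0 G.
  have : (0 < #|e|)%N by rewrite (card_edge eE).
  by rewrite card_gt0 => /set0Pn[v ve]; exists v; apply: edge_vset eE ve.
have B0 : (B !=set0)%classic.
  exists (fun i => (i == v)%:R : R); split.
    by move=> i /=; rewrite in_itv /=; case: eqP => [->|_]; rewrite ?vV ?ler01 ?lexx ?ler0n.
  by rewrite /= /S (bigD1 v) //= eqxx big1 ?addr0 // => i /andP[_ /negbTE->].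
have [|x /set_mem[Ax Sx] xmax] := @compact_EVT_max X R (fun x : X => Qform G x / powsum G x) B B0 cptB.
  apply: continuous_in_subspaceT => x /set_mem[Ax Sx].
  have Nx : powsum G x != 0.
    by rewrite gt_eqF // N_gt0 //; [exact: Agt0|rewrite Sx ltr01].
  exact: cvgM (cF x) (cvgV Nx (cN x)).
have Nx : 0 < powsum G x by rewrite N_gt0 //; [exact: Agt0|rewrite Sx ltr01].
exists x, (Qform G x / powsum G x); split; last exact: A0.
split=> //; [exact: Agt0| |].
  by rewrite divfK ?gt_eqF.
move=> y y0.
have Sy0 : 0 <= S y by apply: sumr_ge0.
(* If [y] vanishes on [V], it equals 0 times itself there, and the scaling lemmas send both forms to
   0. *)
have [Sy|Sy] := eqVneq (S y) 0.
  have yV i : i \in V -> y i = 0 * y i.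
    by move=> iV; rewrite mul0r; apply/eqP; move/eqP: Sy; rewrite psumr_eq0 // => /allP/(_ i); rewrite mem_index_enum iV; apply.
  by rewrite (Qform_scale yV) (powsum_scale yV) expr0n gtn_eqF //= !mul0r mulr0.
have Sy_gt0 : 0 < S y by rewrite lt_neqAle eq_sym Sy.
pose z i := if i \in V then (S y)^-1 * y i else 0.
have zV i : i \in V -> z i = (S y)^-1 * y i by rewrite /z => ->.
have Sz : S z = 1 by rewrite /S (eq_bigr _ zV) -mulr_sumr mulVf.
have z0 i : 0 <= z i by rewrite /z; case: ifP => // _; rewrite mulr_ge0 ?invr_ge0.
have Bz : B (z : X).
  split => // i /=; rewrite in_itv /= z0 /=.
  have [iV|iV] := boolP (i \in V); last by rewrite /z (negbTE iV).
  by rewrite -Sz /S (bigD1 i) //= lerDl sumr_ge0.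
have Ny : 0 < powsum G y by exact: N_gt0.
have := xmax z (mem_set Bz).
rewrite (Qform_scale zV) (powsum_scale zV) -mulf_div divff ?expf_neq0 ?invr_eq0 // mul1r.
by rewrite ler_pdivrMr.
Qed.

(** * One-variable optimization *)

Lemma poly_max_deriv0 (R : realType) (p : {poly R}) (x : R) :
  0 < x -> (forall t, 0 <= t -> p.[t] <= p.[x]) -> p^`().[x] = 0.
Proof.
move=> x0 h.
have d : is_derive x 1 (horner p) 0.
  (* The interval from 0 to [2x] has [x] in its interior, so Fermat's criterion applies. *)
  apply: (@derive1_at_max _ _ 0 (x *+ 2)).
  - by rewrite mulrn_wge0 ?ltW.
  - by move=> t _; exact: derivable_horner.
  - by rewrite in_itv /= x0 mulr2n ltrDl.
  - by move=> t; rewrite in_itv /= => /andP[t0 _]; apply/h/ltW.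
by rewrite -(@derive_val _ _ _ _ _ _ _ (is_derive_poly p x)) (@derive_val _ _ _ _ _ _ _ d).
Qed.

Lemma le0_of_le_small (R : realFieldType) (a b : R) :
  (forall t, 0 < t <= 1 -> b <= a * t) -> b <= 0.
Proof.
move=> h; rewrite leNgt; apply/negP => b0.
have a0 : 0 < a by apply: lt_le_trans b0 _; rewrite -[a]mulr1 h ?ltr01 ?lexx.
have d0 : 0 < a + b by rewrite addr_gt0.
(* For positive [b] this value of [t] gives [b * (a + b) <= a * b], that is [b * b <= 0]. *)
have /h : 0 < b / (a + b) <= 1 by rewrite divr_gt0 //= ler_pdivrMr // mul1r lerDr ltW.
by rewrite mulrA ler_pdivlMr // mulrDr mulrC gerDl leNgt mulr_gt0.
Qed.

(** For [x > 0] the derivative, [k] times the left-hand side, vanishes. At [x = 0] the condition is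
    one-sided: small [t] gives [k b t <= |a| t^k], which with [k >= 2] and [b >= 0] forces
    [b = 0]. *)
Lemma max_binomial_stationary (R : realType) (k : nat) (a b x : R) :
  (2 <= k)%N -> 0 <= b -> 0 <= x ->
  (forall t, 0 <= t -> a * t ^+ k + k%:R * (b * t) <= a * x ^+ k + k%:R * (b * x)) ->
  a * x ^+ k.-1 + b = 0.
Proof.
case: k => [|[|k]] // _ b0; rewrite le_eqVlt => /predU1P[<- h|x0 h].
  rewrite /= expr0n /= mulr0 add0r; apply/eqP; rewrite eq_le b0 andbT.
  apply: (@le0_of_le_small _ `|a|) => t /andP[t0 t1].
  have := h t (ltW t0); rewrite expr0n /= !mulr0 addr0 -lerBrDl sub0r => le1.
  have : k.+2%:R * (b * t) <= `|a| * t ^+ k.+2.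
    by apply: le_trans le1 _; rewrite -mulNr -normrN ler_wpM2r ?ler_norm // exprn_ge0 // ltW.
  rewrite exprSr !mulrA ler_pM2r // => le2.
  have : b <= k.+2%:R * b by rewrite ler_peMl // ler1n.
  move=> /le_trans/(_ le2)/le_trans; apply; rewrite ler_wpM2l //.
  by have t0' := ltW t0; rewrite exprSr ler_piMl // exprn_ile1.
pose p : {poly R} := a *: 'X^(k.+2) + (k.+2%:R * b) *: 'X.
have pE t : p.[t] = a * t ^+ k.+2 + k.+2%:R * (b * t).
  by rewrite hornerD !hornerZ hornerXn hornerX mulrA.
have /(poly_max_deriv0 x0) : forall t, 0 <= t -> p.[t] <= p.[x] by move=> t; rewrite !pE; exact: h.
rewrite derivD !derivZ derivXn derivX hornerD !hornerZ hornerMn hornerXn hornerC mulr1.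
by rewrite -mulr_natl mulrCA -mulrDr => /eqP; rewrite mulf_eq0 pnatr_eq0 /= => /eqP.
Qed.

(** * The tensor in coordinates *)

(** The [i]-th component of the signless Laplacian tensor applied to [x], with ordered tuples
    already collected into edges; [tensor_app_signless] proves the identification. *)
Definition Qapp (R : realType) (T : finType) (k : nat) (G : hypergraph T k)
    (x : T -> R) (i : T) : R :=
  (degree G i)%:R * x i ^+ k.-1 +
  \sum_(e in edges G | i \in e) \prod_(j in (e :\ i)%SET) x j.

Lemma exchange_incident (R : realType) (T : finType) (k : nat) (G : hypergraph T k)
    (f : {set T} -> T -> R) :
  \sum_(i in vset G) \sum_(e in edges G | i \in e) f e i =
  \sum_(e in edges G) \sum_(i in e) f e i.
Proof.
rewrite (exchange_big_dep (mem (edges G))) /=; last by move=> i e _ /andP[].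
apply: eq_bigr => e eE; apply: eq_bigl => i; rewrite eE /=.
by apply: andb_idl; exact: edge_vset.
Qed.

Lemma sum_degree (R : realType) (T : finType) (k : nat) (G : hypergraph T k)
    (f : T -> R) :
  \sum_(i in vset G) (degree G i)%:R * f i = \sum_(e in edges G) \sum_(i in e) f i.
Proof.
rewrite -exchange_incident; apply: eq_bigr => i _.
by rewrite mulr_natl -sumr_const; apply: eq_bigl => e; rewrite inE.
Qed.

(** Multiplying by [x i] completes the product over an edge at [i] to the full edge product, which
    thus appears once for each of the [k] vertices of the edge. *)
Lemma Euler_Qform (R : realType) (T : finType) (k : nat) (k_gt0 : (0 < k)%N)
    (G : hypergraph T k) (x : T -> R) :
  \sum_(i in vset G) x i * Qapp G x i = Qform G x.
Proof.
rewrite /Qform /edge_form /Qapp big_split /=.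
under eq_bigr do rewrite mulrDr.
rewrite big_split /=; congr (_ + _).
  by rewrite -sum_degree; apply: eq_bigr => i _; rewrite mulrCA -exprS prednK.
under eq_bigr do rewrite mulr_sumr.
rewrite exchange_incident; apply: eq_bigr => e eE.
rewrite (eq_bigr (fun=> \prod_(j in e) x j)); first by rewrite sumr_const (card_edge eE) mulr_natl.
by move=> i ie; rewrite (big_setD1 i ie).
Qed.

(** Such a tuple has as many entries as [e] has elements, so it repeats nothing and its tail is an
    ordering of [e] without [i]. The count cancels the factorial in [adjacency_tensor]. *)
Lemma card_tuples_of_set (I : finType) (k : nat) (e : {set I}) (i : I) :
  i \in e -> #|e| = k.+1 ->
  #|[set s : k.+1.-tuple I | (ohead s == Some i) && ([set j in s]%SET == e)]| = k`!.
Proof.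
move=> ie ke.
have ce : #|(e :\ i)%SET| = k by have := cardsD1 i e; rewrite ie ke add1n => -[].
rewrite -ffactnn; rewrite -[X in X ^_ k]ce -card_uniq_tuples.
rewrite -(card_imset _ (_ : injective (fun t : k.-tuple I => [tuple of i :: t]))); last first.
  by move=> t u /(congr1 val) /= -[] /val_inj.
apply: eq_card => s; rewrite !inE; apply/andP/imsetP => [[hd /eqP ime]|[t]].
  case/tupleP: s hd ime => a s /= /eqP[->] ime; exists s => //.
  rewrite inE.
  have u : uniq (i :: s).
    apply/card_uniqP; rewrite /= size_tuple -ke -ime cardsE.
    by apply: eq_card => j; rewrite inE.
  rewrite (cons_uniq i s) in u; case/andP: u => nis ->; rewrite andbT.
  apply/allP => j js; change (j \in (e :\ i)%SET); rewrite !inE -ime inE in_cons js orbT andbT.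
  by apply: contraNneq nis => <-.
rewrite inE => /andP[/allP h u] ->; split => //.
have {}h j : j \in t -> (j != i) && (j \in e) by move=> /h; rewrite -in_setD1.
rewrite eqEcard; apply/andP; split.
  by apply/fintype.subsetP => j; rewrite inE in_cons => /predU1P[->//|/h/andP[]].
rewrite ke cardsE; have /card_uniqP: uniq (i :: t).
  by rewrite /= u andbT; apply/negP => /h; rewrite eqxx.
by rewrite /= size_tuple => <-; rewrite leq_eqVlt; apply/orP; left; apply/eqP; apply: eq_card => j; rewrite inE.
Qed.

Lemma tensor_appD (R : realType) (I : finType) (k : nat) (A B : tensor R I k)
    (x : {ffun I -> R}) (i : I) :
  tensor_app (A + B) x i = tensor_app A x i + tensor_app B x i.
Proof.
rewrite /tensor_app -big_split /=; apply: eq_bigr => s _.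
by rewrite ffunE mulrDl.
Qed.

Lemma tensor_app_degree (R : realType) (T : finType) (k : nat) (k_gt0 : (0 < k)%N)
    (G : hypergraph T k) (x : {ffun vertex G -> R}) (i : vertex G) :
  tensor_app (degree_tensor R G) x i = (degree G (val i))%:R * x i ^+ k.-1.
Proof.
case: k k_gt0 G x i => // k _ G x i.
pose s0 : k.+1.-tuple (vertex G) := [tuple of nseq k.+1 i].
rewrite /tensor_app (bigD1 s0) //= [X in _ + X]big1 ?addr0.
  by rewrite ffunE /= all_pred1_nseq big_nseq iter_mulr_1.
move=> s /andP[/eqP hd ne]; rewrite ffunE hd; case: ifP => [|_]; last by rewrite mul0r.
case/tupleP: s hd ne => a s /= -[->] ne /all_pred1P; rewrite size_tuple => es.
by case/eqP: ne; apply: val_inj; rewrite /= es.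
Qed.

(** Only tuples enumerating an edge through [i] contribute; each such edge has [(k-1)!] of them, all
    with the same monomial and the weight [1/(k-1)!]. *)
Lemma tensor_app_adjacency (R : realType) (T : finType) (k : nat) (k_gt0 : (0 < k)%N)
    (G : hypergraph T k) (x : T -> R) (i : vertex G) :
  tensor_app (adjacency_tensor R G) [ffun v => x (val v)] i =
  \sum_(e in edges G | val i \in e) \prod_(j in (e :\ val i)%SET) x j.
Proof.
case: k k_gt0 G i => // k _ G i.
pose im (s : k.+1.-tuple (vertex G)) := [set val j | j in s]%SET.
have i_im (s : k.+1.-tuple (vertex G)) : ohead s = Some i -> val i \in im s.
  by case/tupleP: s => a s /= [->]; apply: imset_f; rewrite inE eqxx.
rewrite /tensor_app.
rewrite (bigID (fun s => im s \in edges G)) /= addrC big1 ?add0r; last first.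
  by move=> s /andP[_ /negbTE h]; rewrite ffunE h mul0r.
rewrite (partition_big im (fun e => (e \in edges G) && (val i \in e))) /=; last first.
  by move=> s /andP[/eqP/i_im h ->].
apply: eq_bigr => e /andP[eE ie].
(* The edge [e] is read in the subtype of vertices, where the tuples take their entries. *)
pose e' : {set vertex G} := [set v | val v \in e]%SET.
have ime' : [set val j | j in e']%SET = e.
  apply/setP => j; apply/imsetP/idP => [[v]|je]; first by rewrite inE => ? ->.
  by exists (Sub j (edge_vset eE je)); rewrite ?inE SubK.
have imE (s : k.+1.-tuple (vertex G)) : (im s == e) = ([set j in s]%SET == e').
  rewrite -(inj_eq (imset_inj val_inj)) ime'; congr (_ == _).
  by apply/setP => j; apply/imsetP/imsetP => -[v vs ->]; exists v; rewrite ?inE in vs *.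
have ce' : #|e'| = k.+1.
  by move: (card_edge eE); rewrite -ime' card_imset //; exact: val_inj.
rewrite (eq_bigr (fun=> k`!%:R^-1 * \prod_(j in (e :\ val i)%SET) x j)).
  rewrite sumr_const -[LHS]mulr_natl mulrA.
  rewrite (_ : #|_| = k`!) ?divff ?mul1r ?pnatr_eq0 -?lt0n ?fact_gt0 //.
  rewrite -(card_tuples_of_set (_ : i \in e') ce'); last by rewrite inE.
  apply: eq_card => s; rewrite [RHS]inE -imE unfold_in; case: (ohead s == Some i) => //=.
  by case: eqP => [->|]; rewrite ?eE ?andbF.
move=> s /andP[/andP[/eqP hd imE'] /eqP ims]; rewrite ffunE imE'; congr (_ * _).
have us : uniq (map val s).
  apply/card_uniqP; rewrite size_map size_tuple -[RHS](card_edge eE) -ims.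
  apply: eq_card => j; apply/mapP/imsetP => -[v]; by exists v.
case/tupleP: s hd us ims {imE'} => a s /= [->] /andP[nis us] ims.
under eq_bigr do rewrite ffunE.
rewrite -(big_map val xpredT) big_uniq //=.
apply: eq_bigl => j; rewrite !inE -ims.
apply/idP/andP => [js|[ji /imsetP[v]]].
  split; first by apply: contraNneq nis => <-.
  by case/mapP: js => v vs ->; apply: imset_f; rewrite inE vs orbT.
rewrite inE => /predU1P[-> jE|vs ->]; last exact: map_f.
by rewrite jE eqxx in ji.
Qed.

Lemma tensor_app_signless (R : realType) (T : finType) (k : nat) (k_gt0 : (0 < k)%N)
    (G : hypergraph T k) (x : T -> R) (i : vertex G) :
  tensor_app (signless_Laplacian R G) [ffun v => x (val v)] i = Qapp G x (val i).
Proof.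
by rewrite tensor_appD tensor_app_degree // tensor_app_adjacency // ffunE.
Qed.

(** * Dependence on one coordinate, and inequalities *)

(** A vertex occurs at most once in an edge, so in a single coordinate the form is a [k]-th power
    term plus a linear term plus a constant, the shape treated by [max_binomial_stationary]. *)
Lemma Qform_update (R : realType) (T : finType) (k : nat) (G : hypergraph T k)
    (x : T -> R) (i : T) : exists c : R, forall y : T -> R,
  (forall j, j != i -> y j = x j) ->
  Qform G y = (degree G i)%:R * y i ^+ k +
    k%:R * ((\sum_(e in edges G | i \in e) \prod_(j in (e :\ i)%SET) x j) * y i) + c.
Proof.
exists (\sum_(e in edges G | i \in e) \sum_(j in (e :\ i)%SET) x j ^+ k +
  \sum_(e in edges G | i \notin e) edge_form k x e).
move=> y yx; rewrite /Qform (bigID (fun e : {set T} => i \in e)) /= addrA; congr (_ + _); last first.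
  apply: eq_bigr => e /andP[_ ie].
  have ey j : j \in e -> y j = x j by move=> je; apply: yx; apply: contraNneq ie => <-.
  rewrite /edge_form; congr (_ + _ * _); apply: eq_bigr => j je; by rewrite ey.
rewrite (_ : (degree G i)%:R * _ = \sum_(e in edges G | i \in e) y i ^+ k); last first.
  by rewrite mulr_natl -sumr_const; apply: eq_bigl => e; rewrite inE.
rewrite mulr_suml mulr_sumr -!big_split /=; apply: eq_bigr => e /andP[_ ie].
rewrite /edge_form (big_setD1 i ie) /= [X in _ + _ * X](big_setD1 i ie) /=.
rewrite -!addrA; congr (_ + _).
rewrite [RHS]addrC [y i * _]mulrC.
have ey j : j \in (e :\ i)%SET -> y j = x j by rewrite !inE => /andP[ji _]; exact: yx.
by congr (_ + _ * (_ * _)); apply: eq_bigr => j je; rewrite ey.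
Qed.

Lemma powsum_update (R : realType) (T : finType) (k : nat) (G : hypergraph T k)
    (x : T -> R) (i : T) : i \in vset G -> exists c : R, forall y : T -> R,
  (forall j, j != i -> y j = x j) -> powsum G y = y i ^+ k + c.
Proof.
move=> iV; exists (\sum_(j in (vset G :\ i)%SET) x j ^+ k) => y yx.
rewrite /powsum (big_setD1 i iV) /=; congr (_ + _).
by apply: eq_bigr => j; rewrite !inE => /andP[ji _]; rewrite yx.
Qed.

Lemma normr_Qapp_le (R : realType) (T : finType) (k : nat) (G : hypergraph T k)
    (x : T -> R) (i : T) : `|Qapp G x i| <= Qapp G (fun j => `|x j|) i.
Proof.
apply: le_trans (ler_normD _ _) _; rewrite normrM normr_nat normrX lerD2l.
apply: le_trans (ler_norm_sum _ _ _) _; apply: ler_sum => e _.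
by rewrite normr_prod.
Qed.

Lemma edge_form_ge0 (R : realType) (T : finType) (k : nat) (x : T -> R) (e : {set T}) :
  (forall i, 0 <= x i) -> 0 <= edge_form k x e.
Proof.
move=> x0; apply: addr_ge0; first by apply: sumr_ge0 => i _; exact: exprn_ge0.
by apply: mulr_ge0; [exact: ler0n|apply: prodr_ge0].
Qed.

(** AM-GM for the numbers [x i ^+ k], followed by a [k]-th root. *)
Lemma edge_form_le_sum (R : realType) (T : finType) (k : nat) (k_gt0 : (0 < k)%N)
    (x : T -> R) (e : {set T}) :
  (forall i, 0 <= x i) -> #|e| = k -> k%:R * \prod_(i in e) x i <= \sum_(i in e) x i ^+ k.
Proof.
move=> x0 ce.
have S0 : 0 <= \sum_(i in e) x i ^+ k by apply: sumr_ge0 => i _; exact: exprn_ge0.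
have kR : 0 < k%:R :> R by rewrite ltr0n.
have [/=] := @leif_AGM R T (mem e) (fun i => x i ^+ k) (fun i _ => exprn_ge0 k (x0 i)).
rewrite ce prodrXl ler_pXn2r // ?nnegrE ?prodr_ge0 // ?divr_ge0 //.
by rewrite ler_pdivlMr // mulrC.
Qed.

(** Consecutive edges of a chain from [i] to [j] share a vertex, so [P] cannot pass from true to
    false without doing so inside one edge. *)
Lemma hconnected_mixed_edge (T : finType) (k : nat) (G : hypergraph T k) (P : pred T)
    (i j : T) : hconnected G -> i \in vset G -> j \in vset G -> P i -> ~~ P j ->
  exists e, [/\ e \in edges G, exists2 a, a \in e & P a & exists2 b, b \in e & ~~ P b].
Proof.
move=> cG iV jV Pi nPj.
have ij : i != j by apply: contraTneq Pi => ->.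
have [e [es [eE pth ie je]]] := cG i j iV jV ij.
(* The induction on the chain only remembers that its first edge contains a vertex satisfying
   [P]. *)
have : exists2 a, a \in e & P a by exists i.
elim: es e eE pth je {ie} => [|f es IH] e /= /andP[eE esE] pth je Pe.
  by exists e; split => //; exists j.
case/andP: pth => /set0Pn[c]; rewrite inE => /andP[ce cf] pth.
have [Pc|nPc] := boolP (P c); first by apply: (IH f) => //; exists c.
by exists e; split => //; exists c.
Qed.

(** * The largest H-eigenvalue as a maximum *)

(** As a function of the [i]-th coordinate alone, [Qform - l * powsum] is maximal at [x i] among
    nonnegative values; one-variable stationarity gives the equation, also where [x i = 0]. *)
Lemma extremal_Qapp (R : realType) (T : finType) (k : nat) (k_ge2 : (2 <= k)%N)
    (G : hypergraph T k) (l : R) (x : T -> R) :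
  extremal G l x -> forall i, i \in vset G -> Qapp G x i = l * x i ^+ k.-1.
Proof.
move=> [x0 _ xE xmax] i iV.
have [c Qc] := Qform_update G x i.
have [d Nd] := powsum_update x iV.
set b := \sum_(e in edges G | i \in e) \prod_(j in (e :\ i)%SET) x j in Qc *.
have b0 : 0 <= b by apply: sumr_ge0 => e _; exact: prodr_ge0.
suff : ((degree G i)%:R - l) * x i ^+ k.-1 + b = 0.
  by rewrite mulrBl addrAC => /eqP; rewrite subr_eq0 => /eqP.
apply: max_binomial_stationary => // t t0.
pose y j := if j == i then t else x j.
have yx j : j != i -> y j = x j by rewrite /y => /negbTE->.
have yi : y i = t by rewrite /y eqxx.
have y0 j : 0 <= y j by rewrite /y; case: ifP.
have := xmax y y0; rewrite (Qc _ yx) (Nd _ yx) yi => ub.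
move: xE; rewrite (Qc x) // (Nd x) // => xE.
by lra.
Qed.

Lemma powsum_gt0_coord (R : realType) (T : finType) (k : nat) (k_gt0 : (0 < k)%N)
    (G : hypergraph T k) (x : T -> R) :
  (forall i, 0 <= x i) -> 0 < powsum G x -> exists2 i, i \in vset G & 0 < x i.
Proof.
move=> x0 Nx; apply/exists_inP; rewrite -[X in is_true X]negbK negb_exists_in.
apply/negP => /forall_inP h; move: Nx; rewrite /powsum big1 ?ltxx // => i /h.
rewrite -leNgt => xi; have -> : x i = 0 by apply/eqP; rewrite eq_le xi x0.
by rewrite expr0n gtn_eqF.
Qed.

(** With [z] the absolute value of an eigenvector, the triangle inequality gives
    [m * z i ^+ k <= z i * Qapp G z i]. Summing over [i] by [Euler_Qform] bounds [m * powsum G z] by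
    [Qform G z]. *)
Lemma Heigenvalue_le (R : realType) (T : finType) (k : nat) (k_gt0 : (0 < k)%N)
    (G : hypergraph T k) (l m : R) :
  (forall y : T -> R, (forall i, 0 <= y i) -> Qform G y <= l * powsum G y) ->
  Heigenvalues (signless_Laplacian R G) m -> m <= l.
Proof.
move=> ub [y [y0 yE]].
pose Y t := if insub t is Some v then y v else 0.
have Yv v : Y (val v) = y v by rewrite /Y valK.
have yY : y = [ffun v => Y (val v)] by apply/ffunP => v; rewrite ffunE Yv.
pose z t := `|Y t|.
have z0 t : 0 <= z t by exact: normr_ge0.
have Nz : 0 < powsum G z.
  have [v yv] : exists v, y v != 0.
    apply/existsP; apply: contraNT y0; rewrite negb_exists => /forallP h.
    by apply/eqP/ffunP => v; rewrite ffunE; apply/eqP; have := h v; rewrite negbK.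
  rewrite /powsum (big_setD1 (val v)) ?(valP v) //= ltr_pwDl //.
    by rewrite exprn_gt0 // normr_gt0 Yv.
  by apply: sumr_ge0 => j _; exact: exprn_ge0.
rewrite -(ler_pM2r Nz); apply: le_trans (ub z z0).
rewrite -Euler_Qform // /powsum mulr_sumr; apply: ler_sum => i iV.
apply: le_trans (ler_wpM2l (z0 i) (normr_Qapp_le G Y i)).
have := yE (Sub i iV); rewrite {1}yY tensor_app_signless // -Yv SubK => ->.
rewrite normrM normrX mulrCA -exprS prednK // ler_wpM2r ?exprn_ge0 //.
exact: ler_norm.
Qed.

(** The maximum from [exists_extremal] is an H-eigenvalue by [extremal_Qapp] and bounds all others
    by [Heigenvalue_le], so [xget] selects it and does not fall back on its default. *)
Lemma largest_HeigenvalueP (R : realType) (T : finType) (k : nat) (k_ge2 : (2 <= k)%N)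
    (G : hypergraph T k) :
  exists2 x : T -> R, extremal G (largest_Heigenvalue (signless_Laplacian R G)) x
    & forall i, i \notin vset G -> x i = 0.
Proof.
have k_gt0 : (0 < k)%N by exact: ltnW.
have [x [l [ex xV]]] := exists_extremal R k_gt0 G.
have [x0 Nx _ xmax] := ex.
set E := Heigenvalues (signless_Laplacian R G).
have lE : E l.
  exists [ffun v => x (val v)]; split.
    have [i iV xi] := powsum_gt0_coord k_gt0 x0 Nx.
    apply/eqP => /ffunP/(_ (Sub i iV)); rewrite !ffunE SubK => xi0.
    by rewrite xi0 ltxx in xi.
  by move=> v; rewrite tensor_app_signless // ffunE (extremal_Qapp k_ge2 ex) // (valP v).
have lub : ubound E l by move=> m; exact: Heigenvalue_le.
have /(@xgetPex R 0) [lE' lub'] : exists l, (E `&` ubound E)%classic l by exists l.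
exists x => //; rewrite /largest_Heigenvalue -/E.
suff -> : xget 0 (E `&` ubound E)%classic = l by [].
by apply/eqP; rewrite eq_le lub // lub'.
Qed.

(** * Positivity of maximizers on connected hypergraphs *)

Lemma edge_form_le (R : realType) (T : finType) (k : nat) (x y : T -> R) (e : {set T}) :
  (forall i, 0 <= x i <= y i) -> edge_form k x e <= edge_form k y e.
Proof.
move=> xy; apply: lerD.
  by apply: ler_sum => i _; have /andP[x0 xyi] := xy i; rewrite lerXn2r // nnegrE // (le_trans x0).
by apply: ler_wpM2l; [exact: ler0n|apply: ler_prod => i _; exact: xy].
Qed.

(* Raising the zero coordinates of a mixed edge to t adds order t^m, m < k, to
   Qform, but only order t^k to powsum. *)
Lemma extremal_gt0 (R : realType) (T : finType) (k : nat) (k_gt0 : (0 < k)%N)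
    (G : hypergraph T k) (l : R) (x : T -> R) :
  hconnected G -> extremal G l x -> forall i, i \in vset G -> 0 < x i.
Proof.
move=> cG [x0 Nx xE xmax] i iV; rewrite lt_neqAle x0 andbT eq_sym.
apply: contraT; rewrite negbK => /eqP xi0.
have [j jV xj] := powsum_gt0_coord k_gt0 x0 Nx.
(* The support of [x] and its zero set both meet [vset G], so connectedness yields an edge with a
   vertex in each. *)
have [|e [eE [a ae xa] [b be xb]]] := @hconnected_mixed_edge T k G (fun a => x a != 0) j i cG jV iV (lt0r_neq0 xj).
  by rewrite xi0 eqxx.
rewrite negbK in xb.
pose Z := [set z in e | x z == 0]%SET.
have mk : (#|Z| < k)%N.
  rewrite -(card_edge eE); apply: proper_card; apply/properP; split.
    by apply/fintype.subsetP => z; rewrite inE => /andP[].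
  by exists a => //; rewrite inE ae.
pose c := \prod_(z in e | x z != 0) x z.
have c0 : 0 < c by apply: prodr_gt0 => z /andP[_ xz]; rewrite lt_neqAle eq_sym xz x0.
suff : k%:R * c <= 0 by rewrite leNgt mulr_gt0 // ltr0n.
(* After division by [t ^+ #|Z|], maximality leaves the factor [t ^+ (k - #|Z|)], at most [t] since
   [#|Z| < k] and [t <= 1]. *)
apply: (@le0_of_le_small _ `|l * #|Z|%:R|) => t /andP[t0 t1].
pose y z := if z \in Z then t else x z.
have xy z : 0 <= x z <= y z.
  by rewrite x0 /y inE; case: ifP => [/andP[_ /eqP->]|_]; [exact: ltW|exact: lexx].
have y0 z : 0 <= y z by have /andP[h /(le_trans h)] := xy z.
have ZV z : z \in Z -> z \in vset G by rewrite inE => /andP[ze _]; exact: edge_vset eE ze.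
have yk z : y z ^+ k = x z ^+ k + (if z \in Z then t ^+ k else 0).
  rewrite /y; case: ifP => [|_]; last by rewrite addr0.
  by rewrite inE => /andP[_ /eqP->]; rewrite expr0n gtn_eqF // add0r.
have Ny : powsum G y = powsum G x + #|Z|%:R * t ^+ k.
  rewrite /powsum (eq_bigr _ (fun z _ => yk z)) big_split /=; congr (_ + _).
  rewrite -big_mkcondr /= mulr_natl -sumr_const; apply: eq_bigl => z.
  by apply: andb_idl; exact: ZV.
have prody : \prod_(z in e) y z = t ^+ #|Z| * c.
  rewrite (bigID (fun z => x z == 0)) /= -prodr_const; congr (_ * _).
    by apply: eq_big => z; rewrite ?inE // /y inE => ->.
  by apply: eq_bigr => z /andP[_ /negbTE xz]; rewrite /y inE xz andbF.
have prodx : \prod_(z in e) x z = 0 by rewrite (big_setD1 b be) /= (eqP xb) mul0r.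
have Qy : Qform G x + k%:R * (t ^+ #|Z| * c) <= Qform G y.
  rewrite /Qform (bigD1 e eE) [leRHS](bigD1 e eE) /= addrAC; apply: lerD.
    rewrite {1 2}/edge_form prodx mulr0 addr0 prody lerD2r.
    by apply: ler_sum => z _; rewrite yk lerDl; case: ifP => // _; rewrite exprn_ge0 // ltW.
  by apply: ler_sum => f _; exact: edge_form_le.
have := le_trans Qy (xmax y y0); rewrite Ny xE mulrDr lerD2l => h.
have tm : 0 < t ^+ #|Z| by exact: exprn_gt0.
rewrite -(ler_pM2r tm) -mulrA [c * _]mulrC; apply: le_trans h _.
rewrite -mulrA -exprS mulrA.
apply: le_trans (ler_wpM2r _ (ler_norm _)) _; first by rewrite exprn_ge0 // ltW.
apply: ler_wpM2l => //; apply: ler_wiXn2l => //; exact: ltW.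
Qed.

(** * Degree bounds and the complete hypergraph *)

(** Deleting [i] matches these sets with the subsets of [V] without [i] that have [k - 1]
    elements. *)
Lemma card_subsets_with (T : finType) (V : {set T}) (k : nat) (i : T) :
  i \in V -> (0 < k)%N ->
  #|[set e : {set T} | [&& e \subset V, #|e| == k & i \in e]]%SET| = 'C(#|V|.-1, k.-1).
Proof.
case: k => // k iV _; have -> : #|V|.-1 = #|(V :\ i)%SET| by rewrite (cardsD1 i V) iV.
rewrite -cards_draws -[RHS](@card_in_imset _ _ (fun B : {set T} => (i |: B)%SET)); last first.
  move=> B C; rewrite !inE => /andP[/subsetD1P[_ iB] _] /andP[/subsetD1P[_ iC] _] h.
  by rewrite -(finset.setU1K iB) h finset.setU1K.
apply: eq_card => e; rewrite !inE; apply/and3P/imsetP => [[eV ce ie]|[B]].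
  exists (e :\ i)%SET; last by rewrite finset.setD1K.
  by rewrite inE finset.setSD //=; move: ce; rewrite (cardsD1 i e) ie.
rewrite inE => /andP[/subsetD1P[BV iB] /eqP cB] ->.
by rewrite finset.subUset finset.sub1set iV BV cardsU1 iB cB finset.setU11.
Qed.

(** The edges at [i] lie among the [k]-subsets of [vset G] through [i], and a subset of full
    cardinality is everything. The [leqif] form keeps the equality case, which serves both
    directions of the completeness criterion. *)
Lemma degree_leqif (T : finType) (k : nat) (k_gt0 : (0 < k)%N) (G : hypergraph T k) (i : T) :
  i \in vset G ->
  (degree G i <= 'C(#|vset G|.-1, k.-1)
    ?= iff [forall e : {set T}, [&& e \subset vset G, #|e| == k & i \in e] ==> (e \in edges G)])%N.
Proof.
move=> iV; rewrite /degree -(card_subsets_with iV k_gt0).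
set A := [set e in edges G | i \in e]%SET; set B := [set e | _]%SET.
have AB : A \subset B.
  by apply/fintype.subsetP => e; rewrite !inE => /andP[eE ->]; rewrite (edge_subset eE) (card_edge eE) eqxx.
have [le eq] := subset_leqif_card AB; split => //; rewrite eq.
apply/fintype.subsetP/forallP => [h e|h e].
  by apply/implyP => eB; have := h e; rewrite !inE eB => /(_ isT)/andP[].
by rewrite !inE => /[dup] eB /and3P[_ _ ->]; rewrite andbT; have /implyP := h e; exact.
Qed.

Lemma hypergraph_eq (T : finType) (k : nat) (G G' : hypergraph T k) :
  vset G = vset G' -> edges G = edges G' -> G = G'.
Proof.
case: G G' => [V E s u n] [V' E' s' u' n'] /= VV EE.
move: s u n s' u' n'; rewrite VV EE => s u n s' u' n'.
by rewrite (bool_irrelevance s s') (bool_irrelevance u u') (bool_irrelevance n n').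
Qed.

Lemma Qform_subset (R : realType) (T : finType) (k : nat) (G G' : hypergraph T k)
    (x : T -> R) :
  edges G' \subset edges G ->
  Qform G x = Qform G' x + \sum_(e in (edges G :\: edges G')%SET) edge_form k x e.
Proof.
by move=> sE; rewrite /Qform (big_setID (edges G')) /= (finset.setIidPr sE).
Qed.

Lemma powsum_subset (R : realType) (T : finType) (k : nat) (k_gt0 : (0 < k)%N)
    (G G' : hypergraph T k) (x : T -> R) :
  vset G' \subset vset G -> (forall i, i \notin vset G' -> x i = 0) ->
  powsum G x = powsum G' x.
Proof.
move=> sV x0; rewrite /powsum (big_setID (vset G')) /= (finset.setIidPr sV).
by rewrite [X in _ + X]big1 ?addr0 // => i; rewrite inE => /andP[/x0-> _]; rewrite expr0n gtn_eqF.
Qed.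

(* The bound loses only the AM-GM defects of the edges and the degree defects of
   the vertices. *)
Lemma Qform_defect (R : realType) (T : finType) (k : nat) (G : hypergraph T k)
    (C : R) (x : T -> R) :
  2 * C * powsum G x - Qform G x =
  \sum_(e in edges G) (\sum_(i in e) x i ^+ k - k%:R * \prod_(i in e) x i) +
  2 * \sum_(i in vset G) (C - (degree G i)%:R) * x i ^+ k.
Proof.
have -> : \sum_(i in vset G) (C - (degree G i)%:R) * x i ^+ k =
    C * powsum G x - \sum_(e in edges G) \sum_(i in e) x i ^+ k.
  rewrite -sum_degree mulr_sumr -sumrB; apply: eq_bigr => i _; exact: mulrBl.
by rewrite /Qform /edge_form sumrB big_split /=; lra.
Qed.

Lemma Qform_defects_ge0 (R : realType) (T : finType) (k : nat) (k_gt0 : (0 < k)%N)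
    (G : hypergraph T k) (x : T -> R) : (forall i, 0 <= x i) ->
  {in edges G, forall e : {set T}, 0 <= \sum_(i in e) x i ^+ k - k%:R * \prod_(i in e) x i} /\
  {in vset G, forall i,
    0 <= ('C(#|vset G|.-1, k.-1)%:R - (degree G i)%:R) * x i ^+ k}.
Proof.
move=> x0; split=> [e eE|i iV].
  by rewrite subr_ge0 edge_form_le_sum // (card_edge eE).
by rewrite mulr_ge0 ?exprn_ge0 // subr_ge0 ler_nat (degree_leqif k_gt0 iV).
Qed.

Lemma Qform_le_bin (R : realType) (T : finType) (k : nat) (k_gt0 : (0 < k)%N)
    (G : hypergraph T k) (x : T -> R) : (forall i, 0 <= x i) ->
  Qform G x <= 2 * 'C(#|vset G|.-1, k.-1)%:R * powsum G x.
Proof.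
move=> x0; have [e0 v0] := Qform_defects_ge0 k_gt0 G x0.
by rewrite -subr_ge0 Qform_defect addr_ge0 ?mulr_ge0 ?sumr_ge0.
Qed.

(** Used to carry positivity from one vertex to another; the remaining [k - 2] elements come from
    [V] without [i] and [j]. *)
Lemma exists_subset_with2 (T : finType) (V : {set T}) (k : nat) (i j : T) :
  i \in V -> j \in V -> i != j -> (2 <= k <= #|V|)%N ->
  exists e : {set T}, [/\ e \subset V, #|e| = k, i \in e & j \in e].
Proof.
case: k => [|[|k]] // iV jV ij kV.
have jVi : j \in (V :\ i)%SET by rewrite !inE eq_sym ij.
have : (0 < 'C(#|(V :\ i :\ j)%SET|, k))%N.
  by rewrite bin_gt0; move: kV; rewrite (cardsD1 i V) iV (cardsD1 j (V :\ i)%SET) jVi.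
rewrite -cards_draws card_gt0 => /set0Pn[B]; rewrite inE => /andP[/subsetD1P[BVi jB] /eqP cB].
have /subsetD1P[BV iB] := BVi.
exists (i |: (j |: B))%SET; split; rewrite ?inE ?eqxx ?orbT //.
  by rewrite !finset.subUset !finset.sub1set iV jV.
by rewrite !cardsU1 !inE negb_or ij iB jB cB.
Qed.

(** All defects are nonnegative with sum zero, so each vanishes. A vertex with positive coordinate
    then has maximal degree ([full]), hence shares an edge with every other vertex; tightness of
    AM-GM there makes all coordinates positive, so all degrees are maximal. *)
Lemma Qform_bin_complete (R : realType) (T : finType) (k : nat) (k_ge2 : (2 <= k)%N)
    (G : hypergraph T k) (x : T -> R) : (forall i, 0 <= x i) -> 0 < powsum G x ->
  Qform G x = 2 * 'C(#|vset G|.-1, k.-1)%:R * powsum G x -> complete G.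
Proof.
move=> x0 Nx /esym/eqP; rewrite -subr_eq0 Qform_defect.
have k_gt0 : (0 < k)%N by exact: ltnW.
have [e0 v0] := Qform_defects_ge0 k_gt0 G x0.
rewrite paddr_eq0 ?mulr_ge0 ?sumr_ge0 // mulf_eq0 pnatr_eq0 /=.
rewrite psumr_eq0 // psumr_eq0 // => /andP[/allP eq_e /allP eq_v].
have full (i : T) (e : {set T}) : i \in vset G -> 0 < x i ->
    e \subset vset G -> #|e| = k -> i \in e -> e \in edges G.
  move=> iV xi eV ce ie.
  have := eq_v i; rewrite mem_index_enum iV => /(_ isT) /=.
  rewrite mulf_eq0 (gt_eqF (exprn_gt0 _ xi)) orbF subr_eq0 eqr_nat eq_sym.
  have [_ ->] := degree_leqif k_gt0 iV.
  by move=> /forallP/(_ e); rewrite eV ce eqxx ie.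
have [i iV xi] := powsum_gt0_coord k_gt0 x0 Nx.
have k_le : (k <= #|vset G|)%N.
  by have /set0Pn[e eE] := edges_neq0 G; rewrite -[leqLHS](card_edge eE) subset_leq_card // edge_subset.
have pos j : j \in vset G -> 0 < x j.
  move=> jV; have [<-//|ij] := eqVneq i j.
  have [e [eV ce ie je]] := exists_subset_with2 iV jV ij (introT andP (conj k_ge2 k_le)).
  have eE := full i e iV xi eV ce ie.
  rewrite lt_neqAle x0 andbT eq_sym; apply/eqP => xj.
  (* With [x j = 0] the product over [e] vanishes while [x i ^+ k] is positive, so the AM-GM defect
     of [e] could not be zero. *)
  have := eq_e e; rewrite mem_index_enum eE => /(_ isT) /=.
  rewrite [X in _ - _ * X](big_setD1 j je) /= xj mul0r mulr0 subr0.
  rewrite gt_eqF // (big_setD1 i ie) /= ltr_pwDl ?exprn_gt0 //.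
  by apply: sumr_ge0 => a _; exact: exprn_ge0.
apply/setP => e; rewrite inE; apply/idP/andP => [eE|[eV /eqP ce]].
  by rewrite edge_subset // (card_edge eE).
have [a ae] : exists a, a \in e by apply/set0Pn; rewrite -card_gt0 ce.
have aV : a \in vset G by move/fintype.subsetP: eV; exact.
exact: full (pos a aV) eV ce ae.
Qed.

(** On the all-ones vector AM-GM is tight in every edge, and completeness makes every degree
    maximal, so no defect remains. *)
Lemma complete_Qform1 (R : realType) (T : finType) (k : nat) (k_gt0 : (0 < k)%N)
    (G : hypergraph T k) : complete G ->
  Qform G (fun=> 1) = 2 * 'C(#|vset G|.-1, k.-1)%:R * powsum G (fun=> 1 : R).
Proof.
move=> cG; apply/esym/eqP; rewrite -subr_eq0 Qform_defect.
rewrite big1 ?add0r => [|e eE]; last first.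
  rewrite [X in _ - _ * X]big1 ?mulr1 //.
  rewrite (eq_bigr (fun=> 1)) => [|i _]; last by rewrite expr1n.
  by rewrite sumr_const (card_edge eE) subrr.
rewrite big1 ?mulr0 // => i iV; have [_] := degree_leqif k_gt0 iV.
rewrite (_ : [forall e, _]) => [/eqP->|]; first by rewrite subrr mul0r.
by apply/forallP => e; apply/implyP => /and3P[eV ce _]; rewrite cG inE eV ce.
Qed.

(** * Monotonicity, rigidity and the binomial bound *)

Theorem proposition4p2 (R : realType) (T : finType) (k : nat) (k_ge3 : (3 <= k)%N)
    (G G' : hypergraph T k) (subG : subhypergraph G' G) :
  let lambda := largest_Heigenvalue (signless_Laplacian R G) in
  let lambda' := largest_Heigenvalue (signless_Laplacian R G') in
  let n := #|vset G| in
  [/\ lambda' <= lambda,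
      hconnected G' -> hconnected G -> (lambda' = lambda <-> G' = G),
      lambda <= 2 * 'C(n.-1, k.-1)%:R
    & lambda = 2 * 'C(n.-1, k.-1)%:R <-> complete G].
Proof.
move=> l l' n.
have k_ge2 : (2 <= k)%N by exact: ltnW.
have k_gt0 : (0 < k)%N by exact: ltnW.
have [x [x0 Nx xE xmax] _] := largest_HeigenvalueP R k_ge2 G.
have [y [y0 Ny yE ymax] yV'] := largest_HeigenvalueP R k_ge2 G'.
rewrite -/l in xE xmax; rewrite -/l' in yE ymax.
have /andP[sV sE] := subG.
(* Since [y] vanishes off [vset G'], passing to [G] keeps its [powsum] and adds to its [Qform] only
   the nonnegative terms of the extra edges. *)
have Nyy := powsum_subset k_gt0 sV yV'.
have Qyy := Qform_subset y sE.
have rest0 : 0 <= \sum_(e in (edges G :\: edges G')%SET) edge_form k y e.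
  by apply: sumr_ge0 => e _; exact: edge_form_ge0.
have ymaxG := xmax y y0; rewrite Nyy Qyy yE in ymaxG.
split.
- by rewrite -(ler_pM2r Ny); apply: le_trans ymaxG; rewrite lerDl.
- move=> _ cG; split=> [ll|GG]; last by rewrite /l' /l GG.
  rewrite ll gerDl in ymaxG.
  (* Equality leaves no room for the extra edges, so [y] is also extremal for [G] and hence positive
     on [vset G]. *)
  have rest : \sum_(e in (edges G :\: edges G')%SET) edge_form k y e = 0.
    by apply/eqP; rewrite eq_le ymaxG.
  have y_gt0 : forall i, i \in vset G -> 0 < y i.
    apply: (@extremal_gt0 R T k k_gt0 G l) => //.
    by split; rewrite ?Nyy ?Qyy ?yE ?rest ?addr0 ?ll.
  apply: hypergraph_eq; apply/eqP; rewrite finset.eqEsubset ?sV ?sE /=.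
    by apply/fintype.subsetP => i /y_gt0; apply: contraTT => /yV'->; rewrite ltxx.
  (* An extra edge would have a positive form at the positive vector [y], contradicting [rest]. *)
  rewrite -finset.setD_eq0; apply: contraTT isT => /set0Pn[e eD].
  have eE : e \in edges G by move: eD; rewrite inE => /andP[].
  have : 0 < edge_form k y e.
    apply: ltr_wpDl; first by apply: sumr_ge0 => i _; exact: exprn_ge0.
    by rewrite mulr_gt0 ?ltr0n // prodr_gt0 // => i ie; apply/y_gt0/(edge_vset eE).
  move/eqP: rest; rewrite psumr_eq0 => [/allP/(_ e)|f _]; last exact: edge_form_ge0.
  by rewrite mem_index_enum eD => /(_ isT) /= /eqP->; rewrite ltxx.
- by rewrite -(ler_pM2r Nx) -xE; exact: Qform_le_bin.
- split=> [lE|cG]; first by apply: (@Qform_bin_complete R T k k_ge2 G x) => //; rewrite xE lE.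
  apply/eqP; rewrite eq_le -(ler_pM2r Nx) -xE Qform_le_bin //=.
  (* The remaining inequality comes from testing maximality on the all-ones vector. *)
  have N1 : 0 < powsum G (fun=> 1 : R).
    have [i iV _] := powsum_gt0_coord k_gt0 x0 Nx.
    rewrite /powsum (bigD1 i) //= ltr_pwDl ?exprn_gt0 ?ltr01 //.
    by apply: sumr_ge0 => j _; rewrite expr1n ler01.
  by rewrite -(ler_pM2r N1) -complete_Qform1 // xmax // => i; exact: ler01.
Qed.
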